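(* For every integer $n \geq 1$, we have $$ R(F_n) \leq \tfrac{31}{6}n+15. $$
   Context: For an integer $n\ge 1$, the fan $F_n$ is the graph on $2n+1$ vertices consisting of a vertex $v$ (the centre) and $2n$ other vertices $v_1,\dots,v_{2n}$ such that $v v_{2i-1} v_{2i}$ is a triangle for each $i=1,\dots,n$, with no other edges; that is, $F_n$ consists of $n$ triangles all having precisely one common vertex. For a graph $G$, the Ramsey number $R(G)$ is the smallest positive integer $N$ such that every colouring of the edges of the complete graph $K_N$ with two colours contains a monochromatic copy of $G$ (as a not necessarily induced subgraph). *)

(* Defs.v *)
From mathcomp Require Import all_boot.

Set Implicit Arguments.
Unset Strict Implicit.
Unset Printing Implicit Defensive.

Record sgraph := SGraph {
  vertex :> finType;
  edge : rel vertex;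
  edge_sym : symmetric edge;
  edge_irrefl : irreflexive edge }.

(* [None] is the centre v; [Some (i, false)] and [Some (i, true)] are the two
   other vertices v_{2i-1}, v_{2i} of the i-th triangle (i counted from 0). *)
Definition fan_edge (n : nat) : rel (option ('I_n * bool)) := fun x y =>
  match x, y with
  | None, Some _ | Some _, None => true
  | Some (i, a), Some (j, b) => (i == j) && (a != b)
  | None, None => false
  end.

Lemma fan_edge_sym (n : nat) : symmetric (@fan_edge n).
Proof. by case=> [[i a]|] [[j b]|] //=; rewrite eq_sym [a == b]eq_sym. Qed.

Lemma fan_edge_irrefl (n : nat) : irreflexive (@fan_edge n).
Proof. by case=> [[i a]|] //=; rewrite !eqxx. Qed.

Definition fan (n : nat) : sgraph :=
  SGraph (@fan_edge_sym n) (@fan_edge_irrefl n).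

Lemma card_fan (n : nat) : #|fan n| = (2 * n).+1.
Proof. by rewrite card_option card_prod card_ord card_bool mulnC. Qed.

(* A colouring of the edges of K_N assigns a colour to each unordered pair of
   distinct vertices. It is encoded as a function on all subsets of ['I_N];
   only its values on two-element subsets are ever used, since the map [f]
   below is injective and [edge] is irreflexive. *)
Definition has_mono_copy (G : sgraph) (N : nat)
    (c : {ffun {set 'I_N} -> bool}) (b : bool) : bool :=
  [exists f : {ffun G -> 'I_N}, injectiveb f &&
    [forall x, forall y, edge x y ==> (c [set f x; f y] == b)]].

Definition arrows (G : sgraph) (N : nat) : bool :=
  [forall c : {ffun {set 'I_N} -> bool}, exists b, has_mono_copy G c b].

Lemma ramsey_mono_set (s t : nat) : exists N : nat,
  forall (T : finType) (A : {set T}) (c : {set T} -> bool), N <= #|A| ->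
  exists (b : bool) (B : {set T}), #|B| = (if b then s else t) /\
    {in B &, forall x y, x != y -> c [set x; y] = b}.
Proof.
have [m] := ubnP (s + t); elim: m s t => // m IHm [|s] [|t] lt_st_m.
- by exists 0 => T A c _; exists true, set0; split=> [|x]; rewrite ?cards0 ?inE.
- by exists 0 => T A c _; exists true, set0; split=> [|x]; rewrite ?cards0 ?inE.
- by exists 0 => T A c _; exists false, set0; split=> [|x]; rewrite ?cards0 ?inE.
have [|N1 IH1] := IHm s t.+1; first by rewrite -ltnS.
have [|N2 IH2] := IHm s.+1 t; first by rewrite -ltnS -addnS.
exists (N1 + N2).+1 => T A c leA.
have [x Ax] : exists x, x \in A by apply/card_gt0P/(leq_trans _ leA).
rewrite (cardsD1 x) Ax ltnS in leA.
pose A1 b := [set y in A :\ x | c [set x; y] == b].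
have splitA : #|A :\ x| = #|A1 true| + #|A1 false|.
  rewrite -(cardsID [set y | c [set x; y]]); congr (_ + _); apply: eq_card => y;
    rewrite !inE; by case: (c _); rewrite ?andbT ?andbF.
have ext b (B : {set T}) : B \subset A1 b ->
    {in B &, forall y z, y != z -> c [set y; z] = b} ->
    #|x |: B| = #|B|.+1 /\
    {in x |: B &, forall y z, y != z -> c [set y; z] = b}.
  move=> /subsetP sB cB; split.
    by rewrite cardsU1; case: (boolP (x \in B)) => // /sB; rewrite !inE eqxx.
  move=> y z /setU1P[->|By] /setU1P[->|Bz] nyz; first by rewrite eqxx in nyz.
  - by have := sB _ Bz; rewrite inE => /andP[_ /eqP].
  - by have := sB _ By; rewrite inE setUC => /andP[_ /eqP].
  - exact: cB.
have sub b (k l : nat) N0 : N0 <= #|A1 b| ->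
  (forall (T : finType) (A : {set T}) (c : {set T} -> bool), N0 <= #|A| ->
    exists (b : bool) (B : {set T}), #|B| = (if b then k else l) /\
    {in B &, forall x y, x != y -> c [set x; y] = b}) ->
  exists (b' : bool) (B : {set T}), [/\ B \subset A1 b,
    #|B| = (if b' then k else l) &
    {in B &, forall x y, x != y -> c [set x; y] = b'}].
  move=> le0 IH.
  pose S := {y : T | y \in A1 b}.
  have [|b' [B [cardB cB]]] := IH S setT (fun X => c (val @: X)).
    by rewrite cardsT card_sig.
  exists b', (val @: B); split.
  - by apply/subsetP => _ /imsetP[y _ ->]; apply: valP.
  - by rewrite card_imset //; apply: val_inj.
  move=> _ _ /imsetP[y By ->] /imsetP[z Bz ->] nyz.
  by rewrite -(cB y z) // ?imsetU1 ?imset_set1 //; apply: contraNneq nyz => ->.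
have [le1|lt1] := leqP N1 #|A1 true|.
  have [[] [B [sB cardB cB]]] := sub _ _ _ _ le1 IH1; last by exists false, B.
  have [cardxB cxB] := ext _ _ sB cB.
  by exists true, (x |: B); rewrite cardxB cardB.
have le2 : N2 <= #|A1 false|.
  rewrite -(leq_add2l N1) (leq_trans leA) // splitA leq_add2r; exact: ltnW.
have [[] [B [sB cardB cB]]] := sub _ _ _ _ le2 IH2; first by exists true, B.
have [cardxB cxB] := ext _ _ sB cB.
by exists false, (x |: B); rewrite cardxB cardB.
Qed.

Lemma ramsey_ex (G : sgraph) : exists N, (0 < N) && arrows G N.
Proof.
have [N hN] := ramsey_mono_set #|G| #|G|.
exists N.+1; apply/andP; split=> //; apply/forallP => c.
have [|b [B [cardB cB]]] := hN _ [set: 'I_N.+1] c.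
  by rewrite cardsT card_ord.
have {}cardB : #|G| = #|B| by rewrite cardB; case: (b).
pose f (x : G) := enum_val (cast_ord cardB (enum_rank x)).
have f_inj : injective f.
  by move=> x y /enum_val_inj/cast_ord_inj/enum_rank_inj.
apply/existsP; exists b; apply/existsP; exists (finfun f); apply/andP; split.
  by apply/injectiveP => x y; rewrite !ffunE => /f_inj.
apply/forallP => x; apply/forallP => y; apply/implyP => xy; rewrite !ffunE.
apply/eqP/cB; [exact: enum_valP|exact: enum_valP|].
by apply: contraTneq xy => /f_inj ->; rewrite edge_irrefl.
Qed.

Definition ramsey (G : sgraph) : nat := ex_minn (ramsey_ex G).

(* Main.v *)
Require Import Defs.
From mathcomp Require Import all_boot all_order all_fingroup all_algebra zify ring lra.
Import Order.TTheory GRing.Theory Num.Theory.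

Set Implicit Arguments.
Unset Strict Implicit.
Unset Printing Implicit Defensive.

(** Fix a 2-colouring of K_N in which no colour class [c] has a matching of
    size n inside the neighbourhood [nb c x] of a vertex. By Tutte-Berge,
    [nb c x] is the disjoint union of a set [S c x] of size s and a set [D c x]
    that splits into q >= |nb c x| + s - 2n + 2 classes such that all edges
    between different classes have the opposite colour; hence s < n.

    For y in [D c x], compare [D c x] with the classes of [D (~~ c) y]. Apart
    from the class of y and from [S (~~ c) y], it lies in one class of
    [D (~~ c) y] or in one class of [D c x]. If q >= n + 2 the former always
    holds. The other classes of [D (~~ c) y] then form a large set R_y outside
    [D c x], and every z in R_y is joined in colour [~~ c] to at most
    |S (~~ c) y| + 1 elements of a transversal K of the classes of [D c x].
    Counting the pairs (y, z) with y in K and z in R_y bounds |K|.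

    Let x have the largest degree d in some colour c. If q >= n + 2, this count
    is contradictory. Otherwise there is a singleton class {w} for which
    [D c x] = {w} + C + R, with C a class and R inside [S (~~ c) w]. Then
    (w, ~~ c) has at least n + 2 classes and the count is applied to a
    transversal of the classes of [D (~~ c) w] inside C; since C and R are
    completely joined in colour [~~ c], the sets R_y avoid R. For
    8n/3 < d <= 11n/4 one also needs that the elements of this transversal have
    degree at most 8n/3 in colour [~~ c]; otherwise some vertex of R would have
    degree larger than d, being joined to a clique of colour c and to one of
    colour [~~ c]. *)

(** * The Tutte-Berge formula *)

Section Matching.
Variables (T : finType) (g : rel T).
Hypothesis g_sym : symmetric g.
Implicit Types (X S : {set T}) (f h : {perm T}).

(* A matching is the involution that swaps the ends of its edges and fixes the
   uncovered vertices. *)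
Definition matching X f : bool :=
  [forall x, (f (f x) == x) && ((f x != x) ==> (x \in X) && g x (f x))].

Definition moved f : {set T} := [set x | f x != x].

Lemma matchingP X f : reflect
  (involutive f /\ forall x, f x != x -> x \in X /\ g x (f x)) (matching X f).
Proof.
apply: (iffP forallP) => [H|[invf H] x].
  split=> x; first by have /andP[/eqP] := H x.
  by move=> nx; have /andP[_ /implyP/(_ nx)/andP] := H x.
by rewrite invf eqxx; apply/implyP => /H[-> ->].
Qed.

(** [A] takes the end of smaller rank of each swapped pair. It serves to show that a matching moves
    an even number of vertices, and to pick one end of each edge. *)
Lemma moved_half f : involutive f ->
  exists A : {set T}, [/\ #|moved f| = 2 * #|A|, A \subset moved f &
    {in A, forall x, f x \notin A}].
Proof.
move=> invf; pose A := [set x | enum_rank x < enum_rank (f x)].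
have AfA : {in A, forall x, f x \notin A}.
  by move=> x; rewrite !inE invf -leqNgt => /ltnW.
exists A; split=> //; last first.
  by apply/subsetP => x; rewrite !inE; apply: contraTneq => ->; rewrite ltnn.
have -> : moved f = A :|: f @: A.
  apply/setP => x; rewrite !inE; apply/idP/orP => [|[|/imsetP[y]]].
  - rewrite -(inj_eq enum_rank_inj) -(inj_eq val_inj) neq_ltn => /orP[lt|]; last by left.
    by right; apply/imsetP; exists (f x); rewrite ?inE invf.
  - by apply: contraTneq => ->; rewrite ltnn.
  by rewrite inE => lt ->; rewrite invf; apply: contraTneq lt => <-; rewrite ltnn.
rewrite cardsU disjoint_setI0 ?cards0 ?subn0 ?card_imset ?mul2n ?addnn //.
  exact: perm_inj.
rewrite -setI_eq0; apply/eqP/setP => x; rewrite !in_setI in_set0.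
apply: contraTF isT => /andP[xA /imsetP[y yA E]].
by move: xA; rewrite E (negbTE (AfA _ yA)).
Qed.

Lemma matching1 X : matching X 1.
Proof. by apply/matchingP; split=> x; rewrite !perm1 // eqxx. Qed.

Lemma matching_sub X S f : X \subset S -> matching X f -> matching S f.
Proof.
move=> /subsetP sXS /matchingP[invf H]; apply/matchingP; split=> // x nx.
by have [/sXS] := H x nx.
Qed.

Definition maxmatching X f :=
  matching X f && [forall h, matching X h ==> (#|moved h| <= #|moved f|)].

Lemma maxmatchingP X f : reflect
  (matching X f /\ forall h, matching X h -> #|moved h| <= #|moved f|)
  (maxmatching X f).
Proof.
apply: (iffP andP) => [[mf /forallP H]|[mf H]]; split=> //.
  by move=> h mh; have /implyP := H h; apply.
by apply/forallP => h; apply/implyP/H.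
Qed.

Lemma maxmatching_ex X : exists f, maxmatching X f.
Proof.
have [f mf H] := arg_maxnP (fun f => #|moved f|) (matching1 X).
by exists f; apply/maxmatchingP.
Qed.

Lemma matching_glue X f h (O : {set T}) :
    matching X f -> matching X h ->
    {in O, forall x, f x \in O} -> {in O, forall x, h x \in O} ->
  exists2 k, matching X k & forall x, k x = if x \in O then h x else f x.
Proof.
move=> /matchingP[invf Hf] /matchingP[invh Hh] fO hO.
pose k x := if x \in O then h x else f x.
have invk : involutive k.
  move=> x; rewrite /k; have [xO|xO] := boolP (x \in O); first by rewrite hO.
  by rewrite ifN ?invf //; apply: contraNN xO => /fO; rewrite invf.
exists (perm (inv_inj invk)); last by move=> x; rewrite permE.
apply/matchingP; split=> x; rewrite !permE; first exact: invk.
by rewrite /k; case: ifP => _; [apply: Hh | apply: Hf].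
Qed.

(* The orbit of [w] under "f, then h" is an alternating path or cycle. As [w]
   is fixed by [h], it is a path starting in [w], so it has at most one other
   end. *)
Lemma alternating_orbit f h w (p := (f * h)%g) (O := porbit p w) :
    involutive f -> involutive h -> h w = w ->
  [/\ {in O, forall x, f x \in O}, {in O, forall x, h x \in O} &
      {in O &, forall u v, f u = u -> f v = v -> u = v}].
Proof.
move=> invf invh hw.
have pE x : p x = h (f x) by rewrite permM.
have OP x : reflect (exists i, x = iter i p w) (x \in O).
  by apply: (iffP (@porbitP _ p w x)) => -[i ->]; exists i; rewrite permX.
(* Both involutions reverse the orbit: [f] sends the i-th point to the point i + 1 steps before
   [w]. *)
have back i : iter i.+1 p (f (iter i p w)) = w.
  elim: i => [|i IH]; first by rewrite /= pE invf.
  by rewrite iterSr pE invf (iterS i p w) pE invh.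
have fO : {in O, forall x, f x \in O}.
  move=> _ /OP[i ->]; rewrite porbit_sym.
  by apply/porbitP; exists i.+1; rewrite permX back.
split=> //.
  move=> _ /OP[[|i] ->]; first by rewrite /= hw; apply/OP; exists 0.
  by rewrite iterS pE invh; apply/fO/OP; exists i.
have fixP i : f (iter i p w) = iter i p w -> iter (i + i).+1 p w = w.
  by move=> E; rewrite -[RHS](back i) E -iterD addSn.
have mulP a b : iter a p w = w -> iter (b * a) p w = w.
  by move=> E; elim: b => //= b IH; rewrite iterD IH.
(* Fixed points at i and i + m give the periods 2i + 1 and 2m of [w]. As m(2i + 1) is congruent to m
   modulo 2m, m is a period too. *)
have key i m : f (iter i p w) = iter i p w ->
    f (iter (i + m) p w) = iter (i + m) p w -> iter i p w = iter (i + m) p w.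
  move=> /fixP E1 /fixP E2.
  have E3 : iter (m + m) p w = w.
    by rewrite -{1}E1 -iterD -{2}E2; congr (iter _ p w); lia.
  have E4 : iter (m + i * (m + m)) p w = w.
    by rewrite -{2}(mulP _ m E1); congr (iter _ p w); lia.
  by rewrite iterD; congr (iter i p _); rewrite -{1}E4 iterD (mulP _ i E3).
move=> _ _ /OP[i ->] /OP[j ->] fi fj.
have [le|/ltnW le] := leqP i j.
  by have := key i (j - i) fi; rewrite subnKC // => /(_ fj).
by have := key j (i - j) fj; rewrite subnKC // => /(_ fi).
Qed.

(** Replace [f] by [h] along the alternating path from [w]. As [h] is maximum, it covers at least as
    much of this path as [f], so the result is maximum; the path contains at most one vertex missed
    by [f], so [u] or [v] stays missed. *)
Lemma gallai_swap X f h u v w :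
    maxmatching X f -> maxmatching X h -> f u = u -> f v = v -> u != v ->
    h w = w ->
  exists2 k, maxmatching X k & k w = w /\ (k u = u \/ k v = v).
Proof.
move=> /maxmatchingP[mf maxf] /maxmatchingP[mh maxh] fu fv nuv hw.
have [invf _] := matchingP _ _ mf; have [invh _] := matchingP _ _ mh.
have [] := alternating_orbit invf invh hw.
set O := porbit _ w => fO hO fixO.
have [k mk kE] := matching_glue mf mh fO hO.
have [k' mk' k'E] := matching_glue mh mf hO fO.
have Eh : #|moved f :&: O| <= #|moved h :&: O|.
  have := maxh _ mk'; rewrite -(cardsID O (moved k')) -(cardsID O (moved h)).
  have -> : moved k' :&: O = moved f :&: O.
    by apply/setP => x; rewrite !inE k'E; case: ifP; rewrite ?andbF.
  have -> : moved k' :\: O = moved h :\: O.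
    by apply/setP => x; rewrite !in_setD !inE k'E; case: (x \in O).
  by rewrite leq_add2r.
exists k.
  apply/maxmatchingP; split=> // s ms; apply: leq_trans (maxf _ ms) _.
  rewrite -(cardsID O (moved f)) -(cardsID O (moved k)).
  have -> : moved k :&: O = moved h :&: O.
    by apply/setP => x; rewrite !inE kE; case: ifP; rewrite ?andbF.
  have -> : moved k :\: O = moved f :\: O.
    by apply/setP => x; rewrite !in_setD !inE kE; case: (x \in O).
  by rewrite leq_add2r.
split; first by rewrite kE porbit_id.
have [uO|nuO] := boolP (u \in O); last by left; rewrite kE (negbTE nuO).
have [vO|nvO] := boolP (v \in O); last by right; rewrite kE (negbTE nvO).
by rewrite (fixO u v) ?eqxx // in nuv.
Qed.

Lemma matching_adjoin X f u v : u \in X -> v \in X -> u != v -> g u v ->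
  matching X f -> f u = u -> f v = v -> ~~ maxmatching X f.
Proof.
move=> uX vX nuv guv mf fu fv; apply/negP => /maxmatchingP[_ maxf].
have [invf Hf] := matchingP _ _ mf.
have mt : matching X (tperm u v).
  apply/matchingP; split=> x; first exact: tpermK.
  by case: tpermP => [-> _|-> _|]; rewrite ?eqxx // ?(g_sym v).
pose O : {set T} := [set u; v].
have [] := @matching_glue X f (tperm u v) O mf mt.
- by move=> x /set2P[]->; rewrite ?fu ?fv !inE eqxx ?orbT.
- by move=> x /set2P[]->; rewrite ?tpermL ?tpermR !inE eqxx ?orbT.
move=> k mk kE; have := maxf _ mk.
suff : moved f \proper moved k by move=> /proper_card; rewrite ltnNge => /negP.
apply/properP; split.
  apply/subsetP => x; rewrite !inE kE; case: ifP => // /set2P[]->.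
    by rewrite fu eqxx.
  by rewrite fv eqxx.
exists u; last by rewrite inE fu eqxx.
by rewrite inE kE set21 tpermL eq_sym.
Qed.

(* Tutte-Berge formula, the hard inequality: the classes of the labelling [l]
   play the role of the odd components of X :\: S. *)
Lemma tutte_berge X : exists f S (l : T -> {set T}),
  [/\ matching X f, S \subset X,
      {in X :\: S &, forall y z, l y != l z -> ~~ g y z} &
      #|X| + #|S| <= #|l @: (X :\: S)| + #|moved f|].
Proof.
have [m] := ubnP #|X|; elim: m X => // m IH X ltX.
(* Either some [v] is covered by every maximum matching and is put into [S], or every vertex is
   missed by some maximum matching and [S] is empty. *)
have [/existsP[v /andP[vX /forallP cov]]|] := boolP
  [exists v, (v \in X) && [forall f, maxmatching X f ==> (f v != v)]].
  have cX := cardsD1 v X; rewrite vX add1n in cX.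
  have [|f0 [S [l [mf0 sS noE le]]]] := IH (X :\ v); first by rewrite -ltnS -cX.
  have [f maxf] := maxmatching_ex X.
  have [mf leMax] := maxmatchingP _ _ maxf.
  have mf0X := matching_sub (subsetDl _ _) mf0.
  have lt : #|moved f0| < #|moved f|.
    rewrite ltnNge; apply/negP => leff0.
    have /implyP := cov f0; case/(_ _)/negP.
      apply/maxmatchingP; split=> // h mh; exact: leq_trans (leMax _ mh) leff0.
    apply: contraT => nf0; have [_ /(_ v nf0)[]] := matchingP _ _ mf0.
    by rewrite !inE eqxx.
  have XE : X :\: (v |: S) = X :\ v :\: S by rewrite setDDl.
  exists f, (v |: S), l; split=> //.
  - by rewrite subUset sub1set vX (subset_trans sS) ?subsetDl.
  - by rewrite XE.
  rewrite XE cardsU1 (_ : v \notin S); last first.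
    by apply/negP => /(subsetP sS); rewrite !inE eqxx.
  (* Both counts are even, so the strict inequality gains 2: one for [v] leaving [X], one for [v]
     entering [S]. *)
  have [A [cA _ _]] := moved_half (proj1 (matchingP _ _ mf)).
  have [A0 [cA0 _ _]] := moved_half (proj1 (matchingP _ _ mf0)).
  by rewrite cX; move: le lt; rewrite cA cA0; lia.
rewrite negb_exists => /forallP mis.
have {}mis v : v \in X -> exists2 f, maxmatching X f & f v = v.
  move=> vX; have := mis v; rewrite vX negb_forall => /existsP[f].
  by rewrite negb_imply negbK => /andP[mf /eqP]; exists f.
(* By [gallai_swap] this is an equivalence relation on [X]. Its classes are the labels, and a
   maximum matching misses at most one vertex of each. *)
pose r u v := (u == v) || ~~ [exists f, [&& maxmatching X f, f u == u & f v == v]].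
have rP u v f : u != v -> r u v -> maxmatching X f -> f u = u -> f v = v -> False.
  rewrite /r => /negbTE-> /= /existsP H mf fu fv; apply: H; exists f.
  by rewrite mf fu fv !eqxx.
have r_sym u v : r u v = r v u.
  rewrite /r eq_sym; congr (_ || ~~ _); apply/eq_existsb => f.
  by congr (_ && _); rewrite andbC.
have r_trans w u v : w \in X -> r u w -> r w v -> r u v.
  move=> wX ruw rwv; rewrite /r; have [//|nuv /=] := eqVneq u v.
  apply/existsP => -[f /and3P[mf /eqP fu /eqP fv]].
  have [E|nuw] := eqVneq u w.
    by rewrite -E in rwv; exact: rP nuv rwv mf fu fv.
  have [E|nwv] := eqVneq w v.
    by rewrite E in ruw; exact: rP nuv ruw mf fu fv.
  have [h mh hw] := mis w wX.
  have [k mk [kw [ku|kv]]] := gallai_swap mf mh fu fv nuv hw.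
    exact: rP nuw ruw mk ku kw.
  exact: rP nwv rwv mk kw kv.
have [f maxf] := maxmatching_ex X; have [mf _] := maxmatchingP _ _ maxf.
pose l y := [set z in X | r y z].
have lP y z : y \in X -> z \in X -> (l y == l z) = r y z.
  move=> yX zX; apply/eqP/idP => [/setP/(_ z)|ryz].
    by rewrite !inE zX /= => ->; rewrite /r eqxx.
  apply/setP => t; rewrite !inE; have [tX|//] := boolP (t \in X).
  by apply/idP/idP; apply: r_trans => //; rewrite r_sym.
exists f, set0, l; rewrite setD0 cards0 addn0; split=> //; first exact: sub0set.
  move=> y z yX zX; rewrite lP //; apply: contraNN => gyz.
  rewrite /r; have [//|nyz /=] := eqVneq y z.
  apply/existsP => -[h /and3P[mh /eqP hy /eqP hz]].
  have [mh' _] := maxmatchingP _ _ mh.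
  by have := matching_adjoin yX zX nyz gyz mh' hy hz; rewrite mh.
rewrite -(cardsID (moved f) X) addnC; apply: leq_add; last first.
  exact/subset_leq_card/subsetIr.
rewrite -(card_in_imset (f := l) (D := X :\: moved f)); last first.
  move=> y z; rewrite !inE !negbK => /andP[/eqP fy yX] /andP[/eqP fz zX] /eqP.
  rewrite lP // => ryz; apply: contraTeq isT => nyz.
  by case: (rP y z f nyz ryz maxf fy fz).
exact/subset_leq_card/imsetS/subsetDl.
Qed.

End Matching.

(** * Labellings: fibres and transversals *)

Section Labels.
Variables (T : finType) (rT : finType) (f : T -> rT).
Implicit Types A B X : {set T}.

Lemma card_imset_const A : {in A &, forall x y, f x = f y} -> #|f @: A| <= 1.
Proof.
move=> fA; apply/card_le1_eqP => _ _ /imsetP[x xA ->] /imsetP[y yA ->].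
exact: fA.
Qed.

Lemma card_imset_setD A B : #|f @: A| <= #|f @: (A :&: B)| + #|A :\: B|.
Proof.
rewrite -{1}(setID A B) imsetU; apply: leq_trans (leq_card_setU _ _) _.
by rewrite leq_add2l leq_imset_card.
Qed.

Lemma card_fibres A k :
  {in A, forall x, k <= #|[set y in A | f y == f x]|} -> #|f @: A| * k <= #|A|.
Proof.
move=> kA; rewrite -sum_nat_const.
rewrite -[X in _ <= X]sum1_card (partition_big_imset f) /=.
apply: leq_sum => _ /imsetP[x xA ->]; rewrite sum1_card.
by apply: leq_trans (kA x xA) _; rewrite cardsE.
Qed.

Lemma transversal_ex A : exists K : {set T},
  [/\ K \subset A, {in K &, injective f} & #|K| = #|f @: A|].
Proof.
pose h i := odflt i [pick y in A | f y == f i].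
have hP x : x \in A -> h x \in A /\ f (h x) = f x.
  move=> xA; rewrite /h; case: pickP => [y /andP[yA /eqP]//|/(_ x)].
  by rewrite xA eqxx.
have hf x y : f x = f y -> x \in A -> h x = h y.
  move=> E xA; rewrite /h E; case: pickP => [//|/(_ x)].
  by rewrite E eqxx xA.
have K_inj : {in h @: A &, injective f}.
  move=> _ _ /imsetP[x xA ->] /imsetP[y yA ->] E; apply: hf => //.
  by rewrite -(proj2 (hP x xA)) E (proj2 (hP y yA)).
exists (h @: A); split=> //.
  by apply/subsetP => _ /imsetP[x /hP[]? _ ->].
rewrite -(card_in_imset K_inj) -imset_comp.
by have /eq_in_imset -> : {in A, f \o h =1 f} by move=> x /hP[].
Qed.

Lemma sum_fibres A (K : {set T}) : {in K &, injective f} ->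
  \sum_(y in K) #|[set z in A | f z == f y]| <= #|A|.
Proof.
move=> f_inj; under eq_bigr do rewrite -sum1dep_card big_mkcondr.
rewrite exchange_big /= -[X in _ <= X]sum1_card; apply: leq_sum => z _.
rewrite -big_mkcondr sum1dep_card; apply/card_le1_eqP => x y.
rewrite !inE => /andP[xK /eqP Ex] /andP[yK /eqP Ey].
by apply: f_inj; rewrite -?Ex -?Ey.
Qed.

End Labels.

(** If [f] separates [x] from [y], it separates every [z] from one of the two; that one shares its
    [f']-value with [z], and [x] and [y] share theirs. *)
Lemma two_labels (T : finType) (X : {set T}) (rT rT' : eqType)
    (f : T -> rT) (f' : T -> rT') :
    {in X &, forall x y, f x = f y \/ f' x = f' y} ->
  {in X &, forall x y, f x = f y} \/ {in X &, forall x y, f' x = f' y}.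
Proof.
move=> ff'.
have [/forall_inP H|] := boolP [forall x in X, forall y in X, f x == f y].
  by left=> x y xX yX; have /forall_inP/(_ y yX)/eqP := H x xX.
rewrite negb_forall_in => /exists_inP[x xX]; rewrite negb_forall_in.
case/exists_inP => y yX nxy; right.
suff fx z : z \in X -> f' z = f' x by move=> z t /fx-> /fx->.
move=> zX; have [E|//] := ff' z x zX xX.
have [E'|->] := ff' z y zX yX; first by rewrite -E E' eqxx in nxy.
by have [/eqP|//] := ff' x y xX yX; rewrite (negbTE nxy).
Qed.

(** * Counting and arithmetic *)

Section WeightedCount.
Local Open Scope ring_scope.

(* Give each pair (y, z) with z \in R y the weight 1 / s y: every z receives at
   most 1, and 1 / s is bounded below by its tangent line at s = t. *)
Lemma weighted_double_count (T : finType) (K Z : {set T}) (R : T -> {set T})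
    (s b : T -> nat) (t m : nat) :
    (0 < t)%N -> (forall y, 0 < s y)%N -> {in K, forall y, R y \subset Z} ->
    {in K, forall y z, z \in R y -> (#|[set k in K | z \in R k]| <= s y)%N} ->
    {in K, forall y, (m + s y <= #|R y|)%N} ->
    {in K, forall y, (s y + 2 <= t + b y)%N} ->
    (\sum_(y in K) b y <= 2 * #|K|)%N ->
  (#|K| * (t + m) <= #|Z| * t)%N.
Proof.
move=> t_gt0 s_gt0 sZ leU leR les leB.
pose U z := [set y in K | z \in R y].
pose w y : rat := (s y)%:R^-1.
have w_ge0 y : 0 <= w y by rewrite invr_ge0.
have up : \sum_(y in K) (#|R y|%:R * w y) <= #|Z|%:R.
  have -> : \sum_(y in K) (#|R y|%:R * w y) = \sum_(y in K) \sum_(z in R y) w y.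
    by apply: eq_bigr => y _; rewrite sumr_const mulr_natl.
  rewrite (exchange_big_dep (mem Z)) /=; last first.
    by move=> y z yK; apply: (subsetP (sZ y yK)).
  rewrite -[#|Z|]sum1_card natr_sum; apply: ler_sum => z _.
  apply: (@le_trans _ _ (\sum_(y in U z) (#|U z|%:R^-1 : rat))).
    rewrite [leRHS](eq_bigl (fun y => (y \in K) && (z \in R y))); last first.
      by move=> y; rewrite inE.
    apply: ler_sum => y /andP[yK zR].
    rewrite lef_pV2 ?posrE ?ltr0n ?ler_nat ?leU //.
    by apply/card_gt0P; exists y; rewrite inE yK.
  rewrite sumr_const -[_ *+ _]mulr_natl; have [->|nU] := eqVneq #|U z| 0%N.
    by rewrite mul0r.
  by rewrite divff // pnatr_eq0.
rewrite -(ltr0n rat) in t_gt0.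
(* The tangent line gives 1 / s >= (2t - s) / t^2, and 2t - s >= t + 2 - b. Since the [b y] sum to
   at most 2 |K|, the terms t + 2 - b sum to at least t |K|. *)
have low y : y \in K ->
    1 + m%:R * (t%:R + 2 - (b y)%:R) / t%:R ^+ 2 <= #|R y|%:R * w y.
  move=> yK; have := les y yK; have := leR y yK.
  rewrite -!(ler_nat rat) !natrD => sR sb.
  have {}s_gt0 : 0 < (s y)%:R :> rat by rewrite ltr0n.
  apply: (@le_trans _ _ ((m%:R + (s y)%:R) * w y)); last first.
    by rewrite ler_wpM2r.
  rewrite mulrDl addrC /w divff ?gt_eqF // lerD2r -mulrA ler_wpM2l //.
  rewrite ler_pdivrMr ?exprn_gt0 // [_^-1 * _]mulrC ler_pdivlMr //.
  have := sqr_ge0 (t%:R - (s y)%:R : rat).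
  have : 0 <= (s y)%:R * (t%:R + (b y)%:R - (s y)%:R - 2) :> rat.
    by apply: mulr_ge0; [exact: ltW | lra].
  move: t%:R (s y)%:R (b y)%:R => t' u v; nra.
have := le_trans (ler_sum _ low) up.
rewrite big_split /= sumr_const -mulr_suml -mulr_sumr sumrB sumr_const.
rewrite -natr_sum => le1.
rewrite -(ler_nat rat) natrM in leB.
move: le1 leB; set B := (\sum_(y in K) b y)%:R => le1 leB.
rewrite -(ler_nat rat) !natrM natrD.
have : #|K|%:R + m%:R * (t%:R * #|K|%:R) / t%:R ^+ 2 <= #|Z|%:R :> rat.
  apply: le_trans le1; rewrite lerD2l ler_wpM2r ?invr_ge0 ?exprn_ge0 ?(ltW t_gt0) //.
  by rewrite ler_wpM2l // -[(t%:R + 2) *+ _]mulr_natr; nra.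
have -> : m%:R * (t%:R * #|K|%:R) / t%:R ^+ 2 = m%:R * #|K|%:R / t%:R :> rat.
  by field; rewrite gt_eqF.
move=> leK; have := ler_wpM2r (ltW t_gt0) leK.
rewrite [X in X <= _ -> _]mulrDl divfK ?gt_eqF // => {}leK.
by apply: le_trans leK; rewrite mulrDr [_ * m%:R]mulrC.
Qed.

End WeightedCount.

(* In the arithmetic lemmas N is the number of vertices, d the maximal degree,
   a = d - 2n, and 2n + m a lower bound for the degrees that are counted. *)
Lemma many_labels_arith (d a t m q : nat) :
  q * (t + m) <= (d + m + t - 2) * t -> 2 <= t ->
  2 * a + t <= q -> 2 * a * m + 2 * a * t + 2 * t <= d * t.
Proof.
move=> H t2 le.
have : (2 * a + t) * (t + m) <= q * (t + m) by rewrite leq_mul2r le orbT.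
move: H; rewrite mulnBl; nia.
Qed.

Lemma many_labels_arith_max (n a t m : nat) :
  2 * a * m + 2 * a * t + 2 * t <= (2 * n + a) * t ->
  t + a <= n + 1 -> 7 * n + 79 <= 6 * m + 6 * a -> 7 * n + 79 <= 12 * a -> a < n -> False.
Proof.
move=> H ta hm ha an.
have h1 : t * (2 * n - 2 - a) <= (n + 1 - a) * (2 * n - 2 - a) by rewrite leq_mul2r; lia.
have h2 : a * (7 * n + 79) <= a * (6 * m + 6 * a) by rewrite leq_mul2l hm orbT.
have [k ak] : exists k, n = a + k by exists (n - a); lia.
subst n.
nia.
Qed.

Lemma many_labels_arith_mid (n d a t m : nat) : 2 * a * m + 2 * a * t + 2 * t <= d * t ->
  t + a <= n + 1 -> 19 * n + 79 <= 6 * m + 6 * d -> 2 * n < 3 * a ->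
  4 * d <= 11 * n -> a < n -> False.
Proof.
move=> H ta hm ha hd an.
have hm2 : 5 * n + 158 <= 12 * m by lia.
have h2 : a * (5 * n + 158) <= a * (12 * m) by rewrite leq_mul2l hm2 orbT.
have h4 : t * (17 * n) <= (n + 1 - a) * (17 * n) by rewrite leq_mul2r; lia.
have h5 : t * (12 * d) <= t * (24 * a + 17 * n) by rewrite leq_mul2l; lia.
have [k ak] : exists k, 3 * a = 2 * n + k by exists (3 * a - 2 * n); lia.
nia.
Qed.

(** After [k] and [r] are replaced by their lower bounds, adding n - 1 - s' times the inequality m
    <= N + 4n - 2 - 2d - d' eliminates s'. *)
Lemma few_labels_arith (n N d s d' s' k m t r : nat) :
  k * (t + m) <= (N - 1 - (2 * n + 2 - t) - r) * t ->
  2 * n + 2 + s' = d' + t -> 2 <= t -> t <= 2 * n + 2 ->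
  s' + 1 + d <= k + s + 2 * n -> d + s <= r + 2 * n -> r <= s' -> s' < n ->
  d + s < 3 * n -> 2 * n + s < d ->
  m + 2 * d + d' + 2 <= N + 4 * n ->
  (d - s - n) * m <= (3 * n + 1 - d') * (N + 4 * n - 2 - 2 * d - d').
Proof.
move=> H Et t2 tn hk hr rs sn ds ds2 hm.
have h1 : (s' + 1 + d - s - 2 * n) * (t + m) <= k * (t + m) by rewrite leq_mul2r; lia.
have h2 : (N - 1 - (2 * n + 2 - t) - r) * t <=
    (N - 1 - (2 * n + 2 - t) - (d + s - 2 * n)) * t by rewrite leq_mul2r; lia.
have {h1 h2}H := leq_trans h1 (leq_trans H h2).
have [u Eu] : exists u, n = s' + 1 + u by exists (n - 1 - s'); lia.
have [E EE] : exists E, N + 4 * n - 2 = E + 2 * d + d'.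
  by exists (N + 4 * n - 2 - 2 * d - d'); lia.
have -> : N + 4 * n - 2 - 2 * d - d' = E by lia.
have Ek : d - s - n = (s' + 1 + d - s - 2 * n) + u by lia.
have -> : 3 * n + 1 - d' = t + u by lia.
rewrite {}Ek; move: H; set k0 := s' + 1 + d - s - 2 * n.
have EE2 : N - 1 - (2 * n + 2 - t) - (d + s - 2 * n) = E + k0 by rewrite /k0; lia.
rewrite {}EE2 => H.
have : u * m <= u * E by rewrite leq_mul2l; lia.
nia.
Qed.

(** Here and in the next two lemmas v = d - s - n, t = 3n + 1 - d' and E = N + 4n - 2 - 2d - d', as
    in [few_labels_arith]. The ranges are d <= 8n/3, 8n/3 < d <= 11n/4 and d > 11n/4. *)
Lemma few_labels_arith_low (n a m v t E : nat) : v * m <= t * E ->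
  2 * a + 1 <= v -> t + m <= n + 1 -> E + a + 1 <= 2 * n ->
  7 * n + 79 <= 6 * m + 6 * a -> 3 * a <= 2 * n -> 7 * n + 79 <= 12 * a -> False.
Proof.
move=> H hv ht hE hm ha ha2.
have h1 : (2 * a + 1) * m <= v * m by rewrite leq_mul2r hv orbT.
have h2 : t * E <= (n + 1 - m) * (2 * n - 1 - a) by apply: leq_mul; lia.
have {h1 h2}H := leq_trans h1 (leq_trans H h2).
have [x Ex] : exists x, 2 * n = 3 * a + x by exists (2 * n - 3 * a); lia.
have [z Ez] : exists z, 6 * m + 6 * a = 7 * n + 79 + z.
  by exists (6 * m + 6 * a - 7 * n - 79); lia.
nia.
Qed.

Lemma few_labels_arith_mid (n a m v t E D : nat) : v * m <= t * E ->
  2 * a + 1 <= v -> t + m + D <= 3 * n + 1 + a -> E + a + 1 <= 2 * n ->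
  19 * n + 79 <= 6 * m + 6 * D -> 3 * D <= 8 * n ->
  8 * n <= 3 * D + 2 -> 2 * n < 3 * a -> 4 * a <= 3 * n -> False.
Proof.
move=> H hv ht hE hm hD1 hD2 ha ha2.
have h1 : (2 * a + 1) * m <= v * m by rewrite leq_mul2r hv orbT.
have h2 : t * E <= t * (2 * n - 1 - a) by rewrite leq_mul2l; lia.
have h3 : (2 * a + 1) * (3 * n + 79) <= (2 * a + 1) * (6 * m).
  by rewrite leq_mul2l; lia.
have h4 : 6 * t * (2 * n - 1 - a) <= (6 * a - n - 73) * (2 * n - 1 - a).
  by rewrite leq_mul2r; lia.
have {h1 h2 h3 h4}H : (2 * a + 1) * (3 * n + 79) <= (6 * a - n - 73) * (2 * n - 1 - a).
  by move: H h1 h2 h3 h4; rewrite -mulnA; lia.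
have [x Ex] : exists x, 3 * a = 2 * n + x by exists (3 * a - 2 * n); lia.
nia.
Qed.

Lemma few_labels_arith_high (n a m v t E j : nat) : v * m <= t * E ->
  v = 2 * a + 1 + j -> t + 2 * a + j <= 2 * n + 1 -> E + 1 + 3 * a + j <= 3 * n + m ->
  7 * n + 79 <= 6 * m + 6 * a -> 3 * n < 4 * a -> a < n -> False.
Proof.
move=> H hv ht hE hm ha ha2.
have h1 : (2 * a + 1) * m <= v * m by rewrite leq_mul2r; lia.
have h2 : t * E <= (2 * n + 1 - 2 * a) * (3 * n + m - 1 - 3 * a) by apply: leq_mul; lia.
have {h1 h2}H := leq_trans h1 (leq_trans H h2).
have [x Ex] : exists x, n = a + x by exists (n - a); lia.
have [z Ez] : exists z, 4 * a = 3 * n + z by exists (4 * a - 3 * n); lia.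
nia.
Qed.

Lemma few_labels_arith_absurd (n N d s d' s' k m r D0 : nat) :
  31 * n + 85 <= 6 * N -> N <= 2 * d + 1 -> d' < 3 * n -> d' <= d ->
  N <= d' + d + 1 -> s' < n -> s' <= d' -> d' <= s' + 2 * n ->
  r <= s' -> s' + 1 + d <= k + s + 2 * n -> d + s <= r + 2 * n ->
  d <= d' + 1 + s -> d + s < 3 * n -> N = 1 + D0 + 2 * n + m ->
  k * (2 * n + 2 - (d' - s') + m) <=
    (N - 1 - (d' - s') - r) * (2 * n + 2 - (d' - s')) ->
  ~ (D0 = d /\ (3 * d <= 8 * n \/ 11 * n < 4 * d) \/
    [/\ 8 * n < 3 * d, 4 * d <= 11 * n, 3 * D0 <= 8 * n & 8 * n <= 3 * D0 + 2]).
Proof.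
move=> large leN ltd' le_d' geN lts' les' leD' ler gek ger ged' ltds EN H mid.
have [t Et] : exists t, t = 2 * n + 2 - (d' - s') by exists (2 * n + 2 - (d' - s')).
rewrite -Et in H.
have Ed : d' - s' = 2 * n + 2 - t by lia.
rewrite Ed in H.
have leE : m + 2 * d + d' + 2 <= N + 4 * n.
  by case: mid => [[E0 _]|[lt8 le11 D1 D2]]; lia.
have {Ed}H : (d - s - n) * m <= (3 * n + 1 - d') * (N + 4 * n - 2 - 2 * d - d').
  by apply: (few_labels_arith (s' := s') H); lia.
have [a Ea] : exists a, d = 2 * n + a by exists (d - 2 * n); lia.
case: mid => [[E0 [low|high]]|[lt8 le11 D1 D2]].
- by apply: (@few_labels_arith_low n a _ _ _ _ H); lia.
- by apply: (@few_labels_arith_high n a _ _ _ _ (3 * n - 1 - d - s) H); lia.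
by apply: (@few_labels_arith_mid n a _ _ _ _ D0 H); lia.
Qed.

(** * Colourings without a monochromatic fan *)

Section Colouring.
Variables (T : finType) (col : rel T) (n : nat).
Hypothesis col_sym : symmetric col.

Definition adj (c : bool) : rel T := fun x y => (x != y) && (col x y == c).
Definition nb (c : bool) x : {set T} := [set y | adj c x y].

Lemma adj_sym c : symmetric (adj c).
Proof. by move=> x y; rewrite /adj eq_sym col_sym. Qed.

Lemma adjN c x y : adj c x y -> adj (~~ c) x y -> False.
Proof. by case/andP => _ /eqP <- /andP[_]; case: (col x y). Qed.

Lemma adjC c x y : x != y -> ~~ adj c x y -> adj (~~ c) x y.
Proof. by rewrite /adj => -> /=; case: (col x y); case: c. Qed.

Lemma card_nb c x : (#|nb c x| + #|nb (~~ c) x|).+1 = #|T|.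
Proof.
rewrite -cardsT (cardsD1 x [set: T]) inE add1n; congr _.+1.
rewrite -(cardsID (nb c x) (_ :\ _)); congr (_ + _); apply: eq_card => y.
  by rewrite !inE /adj eq_sym; case: eqP.
by rewrite !inE /adj eq_sym; case: eqP; case: (col x y); case: c.
Qed.

Hypothesis no_fan : forall (c : bool) x f,
  matching (adj c) (nb c x) f -> #|moved f| < 2 * n.

Lemma decomposition_ex :
  exists (S : bool -> T -> {set T}) (l : bool -> T -> T -> {set T}), forall c x,
  [/\ S c x \subset nb c x,
      {in nb c x :\: S c x &, forall y z, l c x y != l c x z -> adj (~~ c) y z} &
      #|nb c x| + #|S c x| + 2 <= #|l c x @: (nb c x :\: S c x)| + 2 * n].
Proof.
have H (p : bool * T) : exists (Sl : {set T} * (T -> {set T})),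
    [/\ Sl.1 \subset nb p.1 p.2,
      {in nb p.1 p.2 :\: Sl.1 &,
        forall y z, Sl.2 y != Sl.2 z -> adj (~~ p.1) y z} &
      #|nb p.1 p.2| + #|Sl.1| + 2 <= #|Sl.2 @: (nb p.1 p.2 :\: Sl.1)| + 2 * n].
  case: p => c x /=.
  have [f [S [l [mf sS noE le]]]] := tutte_berge (adj_sym c) (nb c x).
  exists (S, l); split=> //= [y z yD zD nl|].
    by apply: adjC (noE y z yD zD nl); apply: contraNneq nl => ->.
  (* By parity [f] moves at most 2n - 2 vertices, which gives the summand 2. *)
  have [A [cA _ _]] := moved_half (proj1 (matchingP _ _ _ mf)).
  by have := no_fan mf; move: le; rewrite cA /=; move: #|_ @: _|; lia.
have [F FP] := fin_all_exists H.
by exists (fun c x => (F (c, x)).1), (fun c x => (F (c, x)).2) => c x; apply: (FP (c, x)).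
Qed.

Variables (S : bool -> T -> {set T}) (l : bool -> T -> T -> {set T}).
Notation D c x := (nb c x :\: S c x).
Notation q c x := (#|l c x @: (nb c x :\: S c x)|).
Notation blk c x y := [set z in nb c x :\: S c x | l c x z == l c x y].
Notation others c x w lam :=
  [set z in nb c x :\: S c x | (l c x z != l c x w) && (l c x z != lam)].
Hypothesis S_nb : forall c x, S c x \subset nb c x.
Hypothesis l_adj : forall c x,
  {in D c x &, forall y z, l c x y != l c x z -> adj (~~ c) y z}.
Hypothesis q_ge : forall c x, #|nb c x| + #|S c x| + 2 <= q c x + 2 * n.

Lemma card_D c x : #|D c x| + #|S c x| = #|nb c x|.
Proof. by rewrite -(cardsID (S c x) (nb c x)) (setIidPr (S_nb c x)) addnC. Qed.

Lemma card_S c x : #|S c x| < n.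
Proof.
have := q_ge c x; have := card_D c x; have := leq_imset_card (l c x) (D c x); lia.
Qed.

Lemma D_nb c x y : y \in D c x -> y \in nb c x.
Proof. by case/setDP. Qed.

Lemma D_notin c x y : y \in D c x -> x \notin nb (~~ c) y.
Proof.
move=> /D_nb; rewrite !inE => a; apply/negP; rewrite adj_sym; exact: adjN a.
Qed.

Lemma notin_D c x : x \notin D c x.
Proof. by rewrite !inE /adj eqxx andbF. Qed.

(** * The set [D c x] seen from one of its vertices *)

Lemma core_sub c x y : y \in D c x ->
  D c x :\: blk c x y :\: S (~~ c) y \subset D (~~ c) y.
Proof.
move=> yD; apply/subsetP => z; rewrite in_setD => /andP[zS].
rewrite in_setD => /andP[zb zD]; rewrite in_setD zS inE.
apply: (l_adj yD zD); apply: contraNN zb => /eqP E.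
by rewrite inE zD -E eqxx.
Qed.

(** Two vertices of [X] with different labels around both [x] and [y] would be joined in both
    colours. *)
Lemma core_dichotomy c x y (X := D c x :\: blk c x y :\: S (~~ c) y) :
  y \in D c x ->
  {in X &, forall z t, l (~~ c) y z = l (~~ c) y t} \/
  {in X &, forall z t, l c x z = l c x t}.
Proof.
move=> yD; apply: two_labels => z t zX tX.
have [|nE] := eqVneq (l c x z) (l c x t); first by right.
have [|nE'] := eqVneq (l (~~ c) y z) (l (~~ c) y t); first by left.
have zt : adj (~~ c) z t.
  by move: zX tX; rewrite ![_ \in X]in_setD ![_ \in D c x :\: _]in_setD
    => /and3P[_ _ zD] /and3P[_ _ tD]; apply: (l_adj zD tD nE).
by case: (adjN zt); apply: (l_adj _ _ nE'); apply: (subsetP (core_sub yD)).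
Qed.

(** [X] contributes a single label, so (y, [~~ c]) has at most 1 + |nb (~~ c) y| - |W| labels;
    [q_ge] then bounds |W|. *)
Lemma core_card c x y (X := D c x :\: blk c x y :\: S (~~ c) y) :
    y \in D c x -> {in X &, forall z t, l (~~ c) y z = l (~~ c) y t} ->
  #|S (~~ c) y| + #|S (~~ c) y :|: (D c x :\: blk c x y)| < 2 * n.
Proof.
move=> yD /card_imset_const le1; set W := _ :|: _.
have sX := core_sub yD.
have := card_imset_setD (l (~~ c) y) (D (~~ c) y) X; rewrite (setIidPr sX) -/X.
have sub : S (~~ c) y :|: (D c x :\: blk c x y) \subset nb (~~ c) y.
  rewrite subUset S_nb; apply/subsetP => z zD.
  have [zS|zS] := boolP (z \in S (~~ c) y); first exact: (subsetP (S_nb _ _)).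
  by apply/D_nb/(subsetP sX); rewrite in_setD zS.
have <- : nb (~~ c) y :\: W = D (~~ c) y :\: X.
  apply/setP => z; rewrite /W /X !in_setD in_setU !in_setD.
  by case: (z \in S _ _); case: (z \in blk _ _ _); case: (z \in nb c x);
    case: (z \in S c x).
have := cardsID W (nb (~~ c) y); rewrite (setIidPr sub) -/W.
have := q_ge (~~ c) y; lia.
Qed.

(** The class of [y] and the fewer than n vertices of [S (~~ c) y] account for at most n labels. So
    [X] keeps two labels, and only the first case of [core_dichotomy] is left. *)
Lemma many_labels_core c x y (X := D c x :\: blk c x y :\: S (~~ c) y) :
    n + 2 <= q c x -> y \in D c x ->
  {in X &, forall z t, l (~~ c) y z = l (~~ c) y t} /\ exists z, z \in X.
Proof.
move=> big yD.
have bound : q c x <= 1 + #|l c x @: X| + #|S (~~ c) y|.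
  have sub : l c x @: D c x \subset
      [set l c x y] :|: l c x @: X :|: l c x @: S (~~ c) y.
    apply/subsetP => _ /imsetP[z zD ->]; rewrite !in_setU in_set1.
    have [//|nzy] := eqVneq (l c x z) (l c x y).
    have [zS|zS] := boolP (z \in S (~~ c) y); first by rewrite (imset_f (l c x) zS) orbT.
    rewrite (imset_f (l c x)) // /X in_setD zS in_setD zD andbT.
    by rewrite inE zD.
  apply: leq_trans (subset_leq_card sub) _.
  apply: leq_trans (leq_card_setU _ _) _.
  apply: leq_add (leq_imset_card _ _).
  by apply: leq_trans (leq_card_setU _ _) _; rewrite cards1.
have ltS := card_S (~~ c) y; split.
  have [//|/card_imset_const] := core_dichotomy yD; rewrite -/X; lia.
have [X0|[z zX]] := set_0Vmem X; last by exists z.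
by move: bound; rewrite X0 imset0 cards0; lia.
Qed.

Lemma blk_sub c x y : blk c x y \subset D c x.
Proof. by apply/subsetP => z; rewrite inE => /andP[]. Qed.

Lemma card_blk c x y : n + 2 <= q c x -> y \in D c x ->
  #|S (~~ c) y| + #|D c x| < 2 * n + #|blk c x y|.
Proof.
move=> big yD; have [cst _] := many_labels_core big yD.
have := core_card yD cst.
have := subset_leq_card (subsetUr (S (~~ c) y) (D c x :\: blk c x y)).
have := cardsID (blk c x y) (D c x); rewrite (setIidPr (blk_sub _ _ _)); lia.
Qed.

(** If |D c x| = 2n + e with e > 0, then each of the at least n + 2 classes has more than e
    vertices, too many in total. *)
Lemma many_labels_card c x : n + 2 <= q c x -> #|D c x| <= 2 * n.
Proof.
move=> big; rewrite leqNgt; apply/negP => lt.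
have : q c x * (#|D c x| - 2 * n).+1 <= #|D c x|.
  apply: card_fibres => y yD; have := card_blk big yD; move: #|[set _ in _ | _]|.
  lia.
nia.
Qed.

(** [R] consists of the classes of [D (~~ c) y] other than the one that contains [X], so its edges
    to [X] have colour [c]. *)
Lemma outer_ex c x y : n + 2 <= q c x -> y \in D c x -> exists R : {set T},
  [/\ R \subset nb (~~ c) y :\: D c x,
      #|nb (~~ c) y| + #|S (~~ c) y| + 1 <= #|R| + 2 * n &
      {in R & D c x, forall z k, k \notin S (~~ c) y -> l c x k != l c x y ->
        ~~ adj (~~ c) k z}].
Proof.
move=> big yD; have [cst [x0 x0X]] := many_labels_core big yD.
pose X := D c x :\: blk c x y :\: S (~~ c) y.
have XP k : k \in D c x -> k \notin S (~~ c) y -> l c x k != l c x y -> k \in X.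
  by move=> kD kS nl; rewrite in_setD kS in_setD kD inE kD andbT.
pose R := [set z in D (~~ c) y | l (~~ c) y z != l (~~ c) y x0].
have RP : {in R & D c x, forall z k, k \notin S (~~ c) y ->
    l c x k != l c x y -> ~~ adj (~~ c) k z}.
  move=> z k; rewrite inE => /andP[zD nz] kD kS nl.
  have kX := XP k kD kS nl; rewrite -(cst k x0) // eq_sym in nz.
  apply/negP => /adjN; apply.
  by apply: (l_adj _ zD nz); apply: (subsetP (core_sub yD)).
exists R; split=> //.
  apply/subsetP => z zR; have := zR; rewrite inE => /andP[zD' nz].
  rewrite in_setD (D_nb zD') andbT; apply/negP => zD.
  have zS : z \notin S (~~ c) y by case/setDP: zD'.
  have [E|nE] := eqVneq (l c x z) (l c x y); last first.
    by rewrite (cst z x0) ?eqxx // in nz; apply: XP.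
  have := x0X; rewrite in_setD => /andP[x0S]; rewrite in_setD => /andP[x0b x0D].
  have nE0 : l c x x0 != l c x y by move: x0b; rewrite inE x0D.
  have := RP z x0 zR x0D x0S nE0; rewrite (l_adj x0D zD) //.
  by rewrite E.
have : l (~~ c) y @: D (~~ c) y \subset l (~~ c) y x0 |: l (~~ c) y @: R.
  apply/subsetP => _ /imsetP[z zD ->]; rewrite in_setU1.
  have [//|nz] := eqVneq; rewrite imset_f //.
  by rewrite inE zD.
move/subset_leq_card; have := leq_imset_card (l (~~ c) y) R.
have := q_ge (~~ c) y; rewrite cardsU1; case: (_ \notin _); lia.
Qed.

(** If z lies in R_y and in R_k, then k is joined to z in colour [~~ c], so k is [y] or lies in
    [S (~~ c) y]. The condition relating s, t and b is [card_blk]. *)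
Lemma weighted_count c x (K Z : {set T}) m :
    n + 2 <= q c x -> K \subset D c x -> {in K &, injective (l c x)} ->
    #|D c x| <= 2 * #|K| ->
    {in K, forall y, 2 * n + m <= #|nb (~~ c) y|} ->
    {in K, forall y, nb (~~ c) y :\: D c x \subset Z} ->
  #|K| * (2 * n + 2 - #|D c x| + m) <= #|Z| * (2 * n + 2 - #|D c x|).
Proof.
move=> big sK injK leD leN sZ.
have leD2 := many_labels_card big.
have H y : exists R : {set T}, y \in K ->
  [/\ R \subset nb (~~ c) y :\: D c x,
      #|nb (~~ c) y| + #|S (~~ c) y| + 1 <= #|R| + 2 * n &
      {in R & D c x, forall z k, k \notin S (~~ c) y -> l c x k != l c x y ->
        ~~ adj (~~ c) k z}].
  have [yK|] := boolP (y \in K); last by exists set0.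
  by have [R] := outer_ex big (subsetP sK y yK); exists R.
have [R RP] := fin_all_exists H.
apply: (weighted_double_count (R := R) (s := fun y => #|S (~~ c) y|.+1)
  (b := fun y => #|blk c x y|)) => //.
- by rewrite subn_gt0; lia.
- by move=> y yK; have [sR _ _] := RP y yK; apply: subset_trans sR (sZ y yK).
- move=> y yK z zR; have [sR _ nadj] := RP y yK.
  have sub : [set k in K | z \in R k] \subset y |: S (~~ c) y.
    apply/subsetP => k; rewrite inE => /andP[kK kR]; rewrite in_setU1.
    have [//|nky /=] := eqVneq; apply: contraT => kS.
    have nl : l c x k != l c x y by apply: contraNneq nky => /injK->.
    have := nadj z k zR (subsetP sK k kK) kS nl.
    have [/subsetP/(_ z kR)] := RP k kK; rewrite in_setD => /andP[_].
    by rewrite inE => ->.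
  by apply: leq_trans (subset_leq_card sub) _; rewrite cardsU1; case: (_ \notin _).
- by move=> y yK; have [_ + _] := RP y yK; have := leN y yK; lia.
- move=> y yK; have := card_blk big (subsetP sK y yK).
  by move: #|[set _ in _ | _]|; lia.
by apply: leq_trans leD; apply: sum_fibres.
Qed.

Lemma many_labels_ineq c x m :
    n + 2 <= q c x -> (forall y, 2 * n + m <= #|nb (~~ c) y|) ->
  q c x * (2 * n + 2 - #|D c x| + m) <=
    (#|T| - 1 - #|D c x|) * (2 * n + 2 - #|D c x|).
Proof.
move=> big leN; have leD := many_labels_card big.
have [K [sK injK cK]] := transversal_ex (l c x) (D c x).
have -> : #|T| - 1 - #|D c x| = #|~: (x |: D c x)|.
  by rewrite -(cardsC (x |: D c x)) cardsU1 notin_D; lia.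
rewrite -cK; apply: weighted_count => //; first by rewrite cK; lia.
move=> y yK; apply/subsetP => z; rewrite in_setD => /andP[zD zN].
rewrite in_setC in_setU1 negb_or zD andbT.
by apply: contraNneq (D_notin (subsetP sK y yK)) => <-.
Qed.

(** * Vertices with few classes *)

Lemma card_labels_others c x w (lam : {set T}) :
  q c x <= 2 + #|l c x @: others c x w lam|.
Proof.
set R := [set z in _ | _].
have sub : l c x @: D c x \subset [set l c x w; lam] :|: l c x @: R.
  apply/subsetP => _ /imsetP[z zD ->]; rewrite in_setU in_set2.
  have [//|nzw] := eqVneq; have [//|nz0 /=] := eqVneq.
  by rewrite imset_f // inE zD nzw nz0.
apply: leq_trans (subset_leq_card sub) _; apply: leq_trans (leq_card_setU _ _) _.
by rewrite leq_add2r cards2; case: (_ != _).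
Qed.

Lemma few_labels c x : q c x <= n + 1 -> 5 * n + 4 <= 2 * #|nb c x| ->
  exists w (lam : {set T}), [/\ w \in D c x, l c x w != lam,
    {in D c x, forall z, l c x z = l c x w -> z = w},
    others c x w lam \subset S (~~ c) w &
    n + 2 <= q (~~ c) w].
Proof.
move=> few large; have ge_q := q_ge c x; have cD := card_D c x.
have [w0 w0D] : exists w, w \in D c x.
  by apply/card_gt0P; have := leq_imset_card (l c x) (D c x); lia.
have [w wD minw] := arg_minnP (fun y => #|blk c x y|) w0D.
have leb := card_fibres minw.
have ltS := card_S (~~ c) w.
have cb := cardsID (blk c x w) (D c x).
rewrite (setIidPr (blk_sub c x w)) in cb.
(* In the first case even the smallest class, that of [w], has at least 6 vertices, and 6q <= |D c
   x| contradicts [q_ge]. *)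
have [cst|cst] := core_dichotomy wD.
  have := core_card wD cst.
  have := subset_leq_card (subsetUr (S (~~ c) w) (D c x :\: blk c x w)).
  move: leb cb; move: #|blk _ _ _| #|_ :\: blk _ _ _| => b r leb cb le1 le2.
  have b6 : 6 <= b by lia.
  have : q c x * 6 <= q c x * b by rewrite leq_mul2l b6 orbT.
  lia.
have [lam nlam sR] : exists2 lam : {set T}, l c x w != lam &
    others c x w lam \subset S (~~ c) w.
  have [X0|[x0 x0X]] := set_0Vmem (D c x :\: blk c x w :\: S (~~ c) w).
    (* With an empty core any label other than that of [w] will do. *)
    exists (~: l c x w).
      apply/eqP => /setP/(_ x); rewrite in_setC; by case: (x \in _).
    apply/subsetP => z; rewrite inE => /and3P[zD nzw _]; apply: contraT => zS.
    have : z \in D c x :\: blk c x w :\: S (~~ c) w.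
      by rewrite in_setD zS in_setD inE zD andbT.
    by rewrite X0 inE.
  exists (l c x x0).
    have := x0X; rewrite in_setD => /andP[_]; rewrite in_setD inE => /andP[+ x0D].
    by rewrite x0D eq_sym.
  apply/subsetP => z; rewrite inE => /and3P[zD nzw nz0]; apply: contraNT nz0 => zS.
  by apply/eqP/cst => //; rewrite in_setD zS in_setD inE zD andbT.
pose R := others c x w lam.
have leR := card_labels_others c x w lam.
have cRS := subset_leq_card sR; rewrite -/R in leR cRS.
have b1 : #|blk c x w| <= 1.
  (* If all classes had two vertices, [R] would have at least 2(q - 2) elements, more than fit into
     [S (~~ c) w]. *)
  rewrite leqNgt; apply/negP => b2.
  have : #|l c x @: R| * 2 <= #|R|.
    apply: card_fibres => z; rewrite inE => /and3P[zD nzw nz0].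
    apply: leq_trans b2 _; apply: leq_trans (minw z zD) _.
    apply/subset_leq_card/subsetP => t; rewrite !in_set => /andP[tD /eqP E].
    by rewrite E tD nzw nz0 eqxx.
  move: leR cRS; move: #|R| #|l c x @: R| => r lr; lia.
exists w, lam; split=> //.
  move=> z zD E; have /card_le1_eqP H := b1.
  by apply: H; rewrite inE ?E eqxx andbT.
have := q_ge (~~ c) w; have cR := leq_imset_card (l c x) R.
have : D c x :\: blk c x w \subset nb (~~ c) w.
  apply/subsetP => z; rewrite in_setD inE => /andP[nz zD].
  by rewrite inE; apply: (l_adj wD zD); move: nz; rewrite zD eq_sym.
move/subset_leq_card; move: cRS cb b1 leR.
move: cR; move: #|R| #|l c x @: R| #|_ :\: blk _ _ _| #|blk _ _ _| => *; lia.
Qed.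

Lemma singleton_nb c x w : w \in D c x ->
    {in D c x, forall z, l c x z = l c x w -> z = w} ->
  D c x :\ w \subset nb (~~ c) w.
Proof.
move=> wD sing; apply/subsetP => z; rewrite in_setD1 => /andP[nz zD].
by rewrite inE; apply: (l_adj wD zD); apply: contraNneq nz => /esym/sing->.
Qed.

Lemma nb_lt c x : #|nb c x| < 3 * n.
Proof.
have := q_ge c x; have := card_D c x; have := card_S c x.
have [few|many] := leqP (q c x) (n + 1); first lia.
by have := @many_labels_card c x; lia.
Qed.

(** * Vertices of largest degree *)

Section Maximum.
Variable d : nat.
Hypothesis le_d : forall c x, #|nb c x| <= d.
Hypothesis large : 31 * n + 85 <= 6 * #|T|.

Lemma nb_ge c x : #|T| - 1 - d <= #|nb c x|.
Proof. by have := card_nb c x; have := le_d (~~ c) x; lia. Qed.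

(** All degrees are at least N - 1 - d = 2n + m, and the count over a full transversal fails. The
    second alternative is for [few_labels_mid], where the vertex may have degree below d. *)
Lemma many_labels_impossible c x : n + 2 <= q c x -> d < 3 * n ->
  ~ (#|nb c x| = d \/ 8 * n < 3 * #|nb c x| /\ 4 * d <= 11 * n).
Proof.
move=> big ltd Hd; have leD := many_labels_card big.
have [m Em] : exists m, #|T| = 1 + d + 2 * n + m.
  by exists (#|T| - 1 - d - 2 * n); lia.
have leN y : 2 * n + m <= #|nb (~~ c) y| by have := nb_ge (~~ c) y; lia.
have := many_labels_ineq big leN.
have := q_ge c x; have := card_D c x; have := card_S c x; have := card_nb c x.
have := le_d (~~ c) x; have := le_d c x; have := nb_lt c x.
move: #|nb (~~ c) x| #|nb c x| Hd #|S c x| (q c x) #|D c x| leD => d' d2 Hd s k D.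
move=> leD lt2 le2 led' cN lts cD leq H.
have [a Ea] : exists a, d2 = 2 * n + a by exists (d2 - 2 * n); lia.
have [t Et] : exists t, 2 * n + 2 = D + t by exists (2 * n + 2 - D); lia.
have E1 : 2 * n + 2 - D = t by lia.
have E2 : #|T| - 1 - D = d + m + t - 2 by lia.
rewrite E1 E2 in H.
have {}H : 2 * a * m + 2 * a * t + 2 * t <= d * t.
  by apply: (many_labels_arith H); lia.
case: Hd => [Ed|[lt8 le11]].
  by rewrite -Ed Ea in H; apply: (many_labels_arith_max H); lia.
by apply: (@many_labels_arith_mid n _ _ _ _ H); lia.
Qed.

(** If [y] had larger degree, [few_labels] would also apply to it and give a vertex [v]. Some [z1]
    in [R] and [D c v] would then be joined in colour [~~ c] to [K] and to almost a whole
    transversal of [D c v]. *)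
Lemma few_labels_mid c x w lam (K : {set T}) y :
    #|nb c x| = d -> 4 * d <= 11 * n -> d < 3 * n ->
    w \in D c x -> l c x w != lam ->
    K \subset D (~~ c) w -> {in K &, injective (l (~~ c) w)} ->
    {in K, forall k, k \in D c x /\ l c x k = lam} ->
    2 * d + 1 <= #|K| + 4 * n -> y \in K ->
  3 * #|nb (~~ c) y| <= 8 * n.
Proof.
move=> dE le11 ltd wD nlam sK injK KP cK yK; rewrite leqNgt; apply/negP => lt8.
have n_ge : 40 <= n by have := card_nb c x; have := le_d (~~ c) x; lia.
pose R := others c x w lam.
have R_adj z k : z \in R -> k \in K -> adj (~~ c) k z.
  rewrite inE => /and3P[zD nzw nzl] /KP[kD Ek].
  by apply: (l_adj kD zD); rewrite Ek eq_sym.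
have [few|many] := leqP (q (~~ c) y) (n + 1); last first.
  by apply: (@many_labels_impossible (~~ c) y) => //; [lia | right].
have [|v [mu [vD nmu sing]]] := few_labels few; first lia.
rewrite negbK => sR2 bigv.
have sv := singleton_nb vD sing; rewrite negbK in sv.
set R2 := others (~~ c) y v mu in sR2.
have leq := card_labels_others c x w lam; rewrite -/R in leq.
have leq2 := card_labels_others (~~ c) y v mu; rewrite -/R2 in leq2.
have ge_q := q_ge c x; have ge_q2 := q_ge (~~ c) y.
have ltS3 := card_S c v; have cD2 := card_D (~~ c) y.
have ge_q3 : 2 * #|nb (~~ c) y| + 1 <= q c v + 4 * n.
  have := q_ge c v; have := subset_leq_card sv.
  have := cardsD1 v (D (~~ c) y); rewrite vD.
  have := subset_leq_card sR2; have := leq_imset_card (l (~~ c) y) R2.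
  move: #|R2| #|l (~~ c) y @: R2| leq2 #|_ :\ v|.
  clear -cD2 ge_q2; move: (q c v) (q (~~ c) y) cD2 ge_q2 => *; lia.
have le_d2 := le_d (~~ c) y.
have sRD2 z : z \in R -> z \notin S (~~ c) y -> z \in D (~~ c) y.
  by move=> zR zS; rewrite in_setD zS inE R_adj.
pose R' := R :\: S (~~ c) y.
have cR' : #|R| <= #|R'| + #|S (~~ c) y|.
  by rewrite -(cardsID (S (~~ c) y) R) addnC leq_add2l subset_leq_card ?subsetIr.
(* Otherwise [R'] lies in one class of [D c x], and [R] has at most 1 + |S (~~ c) y| labels, fewer
   than q - 2. *)
have constR' : {in R' &, forall z t, l (~~ c) y z = l (~~ c) y t}.
  have [//|cst] : {in R' &, forall z t, l (~~ c) y z = l (~~ c) y t} \/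
      {in R' &, forall z t, l c x z = l c x t}.
    apply: two_labels => z t /setDP[zR zS] /setDP[tR tS].
    have [|nE] := eqVneq (l c x z) (l c x t); first by right.
    have [|nE'] := eqVneq (l (~~ c) y z) (l (~~ c) y t); first by left.
    have zD : z \in D c x by move: zR; rewrite inE => /and3P[].
    have tD : t \in D c x by move: tR; rewrite inE => /and3P[].
    case: (adjN (l_adj zD tD nE)).
    exact: l_adj (sRD2 z zR zS) (sRD2 t tR tS) nE'.
  have := card_imset_const cst; have := card_imset_setD (l c x) R R'.
  have : R :\: R' \subset S (~~ c) y.
    apply/subsetP => z; rewrite !in_setD negb_and negbK => /andP[/orP[//|]].
    by move=> /negbTE ->.
  rewrite (setIidPr (subsetDl _ _)) -/R' => /subset_leq_card.
  move: #|R :\: R'| #|l c x @: R| leq #|l c x @: R'| => r r1 leq r2.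
  clear -leq ge_q ge_q2 few le_d2 lt8 dE n_ge; lia.
(* Otherwise [R2] and [R'] both lie in [v |: S c v], of size at most n; as they share at most one
   label, they do not fit. *)
have [z1 z1R z1D] : exists2 z, z \in R & z \in D c v.
  have [/existsP[z /andP[]]|] := boolP [exists z, (z \in R) && (z \in D c v)].
    by exists z.
  rewrite negb_exists => /forallP nex.
  have sR' : R' :\ v \subset S c v.
    apply/subsetP => z; rewrite in_setD1 => /andP[nz /setDP[zR zS]].
    have := nex z; rewrite zR /= in_setD negb_and negbK => /orP[//|].
    by rewrite (subsetP sv) // in_setD1 nz sRD2.
  pose W := R2 :|: R'.
  have cW : #|W| <= n.
    have : W \subset v |: S c v.
      apply/subsetP => z; rewrite [z \in W]in_setU in_setU1 => /orP[/(subsetP sR2)->|zR'].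
        by rewrite orbT.
      by have [//|nz /=] := eqVneq; apply: (subsetP sR'); rewrite in_setD1 nz.
    move/subset_leq_card; rewrite cardsU1; case: (_ \notin _); clear -ltS3; lia.
  have := card_imset_setD (l (~~ c) y) R2 R'.
  have := subset_leq_card (imsetS (l (~~ c) y) (subsetIr R2 R')).
  have := card_imset_const constR'.
  have := cardsID R' W; rewrite setIC (setIidPl (subsetUr _ _)).
  have -> : W :\: R' = R2 :\: R' by rewrite setDUl setDv setU0.
  have := card_nb c x; have := le_d (~~ c) x; have := leq_imset_card (l c x) R.
  move: #|R| #|l c x @: R| cR' leq => r0 r1 cR' leq.
  move: #|W| cW #|R2 :\: R'| #|l (~~ c) y @: (R2 :&: R')| => w' cW r2 r3.
  move: #|l (~~ c) y @: R'| #|l (~~ c) y @: R2| leq2 => r4 r5 leq2.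
  clear -leq leq2 ge_q ge_q2 cR' cW lt8 le_d2 dE n_ge; lia.
have [Q [sQ injQ cQ]] := transversal_ex (l c v) (D c v).
pose Q' := [set k in Q | l c v k != l c v z1].
have cQ' : #|Q| <= #|Q'| + 1.
  rewrite -(cardsID Q' Q) (setIidPr _); last first.
    by apply/subsetP => k; rewrite inE => /andP[].
  rewrite leq_add2l; apply/card_le1_eqP => k k'; rewrite !in_setD !inE.
  case/andP => + kQ /andP[+ k'Q]; rewrite kQ k'Q /= !negbK => /eqP Ek /eqP Ek'.
  by apply: injQ => //; rewrite Ek Ek'.
(* [K] is a clique of colour [c], and [Q'] is one of colour [~~ c]. *)
have cKQ : #|K :&: Q'| <= 1.
  apply/card_le1_eqP => k k'; rewrite !in_setI => /andP[kK kQ'] /andP[k'K k'Q'].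
  have [kQ k'Q] : k \in Q /\ k' \in Q.
    by move: kQ' k'Q'; rewrite !inE => /andP[-> _] /andP[-> _].
  apply: contraTeq isT => nk.
  have a1 : adj (~~ c) k k'.
    apply: (l_adj (subsetP sQ k kQ) (subsetP sQ k' k'Q)).
    by apply: contraNneq nk => /injQ->.
  case: (adjN a1); apply: (l_adj (subsetP sK k kK) (subsetP sK k' k'K)).
  by apply: contraNneq nk => /injK->.
have sN : K :|: Q' \subset nb (~~ c) z1.
  apply/subsetP => k; rewrite in_setU [k \in nb _ _]inE => /orP[kK|].
    by rewrite adj_sym R_adj.
  rewrite inE => /andP[kQ nk].
  by apply: (l_adj z1D (subsetP sQ k kQ)); rewrite eq_sym.
(* So [z1] has degree at least 2d + 2 |nb (~~ c) y| - 8n, which exceeds d since d >= |nb (~~ c) y| >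
   8n/3. *)
have := subset_leq_card sN; rewrite cardsU; have := le_d (~~ c) z1.
rewrite -cQ in ge_q3; clear -cK cQ' cKQ ge_q3 lt8 le_d2; lia.
Qed.

Lemma few_labels_impossible c x : #|nb c x| = d -> n + 1 < q c x.
Proof.
move=> dE; rewrite ltnNge; apply/negP => few.
have ltd := nb_lt c x; rewrite dE in ltd.
have leT : #|T| <= 2 * d + 1 by have := card_nb c x; have := le_d (~~ c) x; lia.
have [|w [lam [wD nlam sing sR big]]] := few_labels few; first lia.
have := card_labels_others c x w lam; set R := others c x w lam in sR *.
move=> leq; have {leq}cR : d + #|S c x| <= #|R| + 2 * n.
  by have := q_ge c x; have := leq_imset_card (l c x) R; lia.
pose C := [set z in D c x | l c x z == lam].
have [K [sKC injK cK]] := transversal_ex (l (~~ c) w) (D (~~ c) w :&: C).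
have sK : K \subset D (~~ c) w := subset_trans sKC (subsetIl _ _).
have KP : {in K, forall k, k \in D c x /\ l c x k = lam}.
  move=> k /(subsetP sKC); rewrite in_setI [k \in C]inE => /andP[_].
  by case/andP => kD /eqP.
have cD := card_D c x; have cD' := card_D (~~ c) w.
have ltS' := card_S (~~ c) w; have ge_q' := q_ge (~~ c) w.
have sv := singleton_nb wD sing; have cDw := cardsD1 w (D c x); rewrite wD in cDw.
have ge_d' : #|D c x| <= #|nb (~~ c) w| + 1.
  by have := subset_leq_card sv; lia.
have cDCR : #|D c x| <= 1 + (#|C| + #|R|).
  have : D c x \subset w |: (C :|: R).
    apply/subsetP => z zD; rewrite in_setU1 in_setU.
    rewrite [z \in C]inE [z \in R]inE zD /=.
    have [/(sing z zD)->|nzw] := eqVneq (l c x z) (l c x w); first by rewrite eqxx.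
    by case: (_ == lam); rewrite ?orbT.
  move/subset_leq_card/leq_trans; apply.
  apply: leq_trans (leq_card_setU _ _) _; rewrite cards1 leq_add2l.
  exact: leq_card_setU.
have cCD : #|C :\: D (~~ c) w| + #|R| <= #|S (~~ c) w|.
  have : C :\: D (~~ c) w \subset S (~~ c) w :\: R.
    apply/subsetP => z; rewrite in_setD [z \in C]inE => /and3P[zD' zD /eqP Ez].
    have nz : z != w by apply: contraNneq nlam => <-; apply/eqP.
    rewrite in_setD [z \in R]inE Ez eqxx !andbF /=; apply: contraNT zD' => zS.
    by rewrite in_setD zS (subsetP sv) // in_setD1 nz.
  move/subset_leq_card; have := cardsID R (S (~~ c) w); rewrite (setIidPr sR); lia.
have cK' : #|S (~~ c) w| + 1 + d <= #|K| + #|S c x| + 2 * n.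
  have := card_imset_setD (l (~~ c) w) (D (~~ c) w) C; rewrite -cK.
  have := cardsID C (D (~~ c) w); have := cardsID (D (~~ c) w) C.
  by rewrite [C :&: _]setIC; lia.
have ltR : #|R| <= #|S (~~ c) w| := subset_leq_card sR.
have wR : w \notin R by rewrite inE eqxx andbF.
(* Vertices of [K] have label [lam] and are joined to [R] in colour [~~ c], so their neighbours in
   colour [c] avoid [R]. *)
pose Z := ~: (w |: (D (~~ c) w :|: R)).
have cZ : #|Z| = #|T| - 1 - #|D (~~ c) w| - #|R|.
  have dis : D (~~ c) w :&: R = set0.
    apply/setP => z; rewrite in_setI in_set0 in_setD.
    by have [/(subsetP sR)->|] := boolP (z \in R); rewrite ?andbF.
  have := cardsC (w |: (D (~~ c) w :|: R)); rewrite -/Z cardsU1 cardsU dis cards0.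
  by rewrite in_setU negb_or wR notin_D; lia.
have leD' := many_labels_card big.
have le_d' := le_d (~~ c) w; have ltd' := nb_lt (~~ c) w; have ge_N := nb_ge (~~ c) w.
have sZ : {in K, forall y, nb c y :\: D (~~ c) w \subset Z}.
  move=> y yK; have [yD Ey] := KP y yK; apply/subsetP => z.
  rewrite in_setD => /andP[zD' zN]; rewrite in_setC in_setU1 in_setU !negb_or zD' /=.
  apply/andP; split.
    have := D_notin (subsetP sK y yK); rewrite negbK.
    by apply: contraNneq => <-.
  move: zN; rewrite inE => zN; apply: contraTN isT => zR.
  have zD : z \in D c x by move: zR; rewrite inE => /and3P[].
  case: (adjN zN); apply: (l_adj yD zD).
  by rewrite Ey eq_sym; move: zR; rewrite inE => /and3P[].
(* [D0] bounds the degrees in colour [~~ c] on [K]: it is d or, in the middle range, the integer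
   part of 8n/3 by [few_labels_mid]. *)
have [m [D0 [Em leN mid]]] : exists m D0, [/\ #|T| = 1 + D0 + 2 * n + m,
    {in K, forall y, 2 * n + m <= #|nb c y|} &
    D0 = d /\ (3 * d <= 8 * n \/ 11 * n < 4 * d) \/
    [/\ 8 * n < 3 * d, 4 * d <= 11 * n, 3 * D0 <= 8 * n & 8 * n <= 3 * D0 + 2]].
  have [/andP[lt8 le11]|] := boolP ((8 * n < 3 * d) && (4 * d <= 11 * n)); last first.
    rewrite negb_and -leqNgt -ltnNge => /orP H; exists (#|T| - 1 - d - 2 * n), d.
    split; [lia | | by left].
    by move=> y _; have := nb_ge c y; lia.
  pose D0 := 8 * n %/ 3; have [D1 D2] : 3 * D0 <= 8 * n /\ 8 * n <= 3 * D0 + 2.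
    by clear; rewrite /D0; lia.
  exists (#|T| - 1 - D0 - 2 * n), D0; split; [lia | | by right].
  move=> y yK; have := card_nb c y.
  have le8 : 3 * #|nb (~~ c) y| <= 8 * n.
    apply: few_labels_mid wD nlam sK injK KP _ yK => //.
    by clear -cK' cR ltR; lia.
  clear -le8 D2 large leT; lia.
have H : #|K| * (2 * n + 2 - #|D (~~ c) w| + m) <=
    #|Z| * (2 * n + 2 - #|D (~~ c) w|).
  by apply: weighted_count => //; rewrite ?negbK //; lia.
rewrite cZ in H.
have ltS := card_S c x; have ge_q := q_ge c x.
have E' : #|D (~~ c) w| = #|nb (~~ c) w| - #|S (~~ c) w| by lia.
rewrite E' in H leD'.
apply: (few_labels_arith_absurd _ _ _ _ _ _ _ _ ltR cK' cR _ _ Em H mid);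
  clear -large dE leT ltd' le_d' ge_N ltS' cD cD' leD' ge_d' ltd few ge_q; lia.
Qed.

End Maximum.
End Colouring.

(** * From matchings to fans *)

Lemma large_matching_ex (T : finType) (col : rel T) n :
    symmetric col -> 31 * n + 85 <= 6 * #|T| ->
  exists c x f, matching (adj col c) (nb col c x) f /\ 2 * n <= #|moved f|.
Proof.
move=> col_sym large.
pose bad (p : bool * T * {perm T}) :=
  matching (adj col p.1.1) (nb col p.1.1 p.1.2) p.2 && (2 * n <= #|moved p.2|).
have [/existsP[[[c x] f] /andP[]]|] := boolP [exists p, bad p].
  by exists c, x, f.
rewrite negb_exists => /forallP no_fan.
have {}no_fan c x f : matching (adj col c) (nb col c x) f -> #|moved f| < 2 * n.
  by move=> mf; have := no_fan (c, x, f); rewrite /bad /= mf -ltnNge.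
have [S [l Sl]] := decomposition_ex col_sym no_fan.
have S_nb c x : S c x \subset nb col c x by have [] := Sl c x.
have l_adj c x := let: And3 _ H _ := Sl c x in H.
have q_ge c x := let: And3 _ _ H := Sl c x in H.
have /card_gt0P[x0 _] : 0 < #|T| by lia.
have [[c x] _ maxcx] := @arg_maxnP _ (true, x0) xpredT
  (fun p : bool * T => #|nb col p.1 p.2|) isT.
have le_d c' x' : #|nb col c' x'| <= #|nb col c x| by exact: (maxcx (c', x')).
have many := few_labels_impossible col_sym S_nb l_adj q_ge le_d large erefl.
case: (@many_labels_impossible _ _ _ col_sym _ _ S_nb l_adj q_ge _ le_d large c x).
- by rewrite addnS.
- exact: nb_lt.
by left.
Qed.

(** A matching of n edges of colour [b] among the [b]-neighbours of [x] spans a fan with centre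
    [x]. *)
Lemma fan_arrows n N : 31 * n + 85 <= 6 * N -> arrows (fan n) N.
Proof.
move=> large; apply/forallP => c.
pose col x y := c [set x; y].
have col_sym : symmetric col by move=> x y; rewrite /col setUC.
have [|b [x [f [mf cf]]]] := @large_matching_ex 'I_N col n col_sym.
  by rewrite card_ord.
have [invf Hf] := matchingP _ _ _ mf.
have [A [cA sA fA]] := moved_half invf.
have leA : n <= #|A| by move: cf; rewrite cA; lia.
pose a (i : 'I_n) : 'I_N := enum_val (widen_ord leA i).
have aA i : a i \in A by exact: enum_valP.
have a_inj : injective a.
  by move=> i j /enum_val_inj E; apply: val_inj; exact: (congr1 val E).
have a_moved i : f (a i) != a i by have := subsetP sA _ (aA i); rewrite inE.
have x_a i : adj col b x (a i) by have [] := Hf _ (a_moved i); rewrite inE.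
have a_fa i : adj col b (a i) (f (a i)) by have [] := Hf _ (a_moved i).
have x_fa i : adj col b x (f (a i)).
  by have [] := Hf (f (a i)); rewrite ?inE // invf eq_sym.
pose g (v : fan n) := match v with
  | None => x | Some (i, false) => a i | Some (i, true) => f (a i) end.
have g_adj u v : fan_edge u v -> adj col b (g u) (g v).
  case: u v => [[i s]|] [[j t]|] //=; last 2 first.
  - by case: s; rewrite adj_sym.
  - by case: t.
  by case/andP => /eqP <-; case: s; case: t => // _; rewrite adj_sym.
have g_inj : injective g.
  move=> u v E; have [//|nuv] := eqVneq u v.
  have nE : ~~ fan_edge u v by apply/negP => /g_adj /andP[]; rewrite E eqxx.
  case: u v E nE nuv => [[i s]|] [[j t]|] //=.
  case: s; case: t => /=.
  - by move=> /perm_inj/a_inj->; rewrite eqxx.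
  - by move=> E; have := fA _ (aA i); rewrite E aA.
  - by move=> E; have := fA _ (aA j); rewrite -E aA.
  - by move=> /a_inj->; rewrite eqxx.
apply/existsP; exists b; apply/existsP; exists (finfun g); apply/andP; split.
  by apply/injectiveP => u v; rewrite !ffunE => /g_inj.
apply/forallP => u; apply/forallP => v; apply/implyP => uv; rewrite !ffunE.
by have /andP[] := g_adj u v uv.
Qed.

Local Open Scope ring_scope.

Theorem theorem1p1 (n : nat) (hn : (1 <= n)%N) :
  (ramsey (fan n))%:R <= 31 / 6 * n%:R + 15 :> rat.
Proof.
(* Six consecutive integers contain a multiple of 6, and 90 = 6 * 15. *)
have [k [k_lo k_hi]] : exists k, (31 * n + 85 <= 6 * k /\ 6 * k <= 31 * n + 90)%N.
  by exists ((31 * n + 90) %/ 6)%N; lia.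
have le_k : (ramsey (fan n) <= k)%N.
  rewrite /ramsey; case: ex_minnP => m _; apply.
  by rewrite fan_arrows // andbT; lia.
have : (6 * ramsey (fan n))%:R <= (31 * n + 90)%:R :> rat by rewrite ler_nat; lia.
rewrite natrD !natrM; lra.
Qed.
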